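(* Let $\mathbb{F}$ be a field, let $d \ge 0$ be an integer, and let $V$ be a vector space over $\mathbb{F}$ of dimension $d+1$. Let $\Phi = (\{E_i\}_{i=0}^d; \{E^*_i\}_{i=0}^d)$ denote a sequence of elements in $\mathrm{End}(V)$. Then the following are equivalent: (i) $\Phi$ is a symmetric idempotent system on $V$ that is $P$-polynomial and $Q$-polynomial; (ii) there exist $A$, $A^*$ in $\mathrm{End}(V)$ such that $(A; \{E_i\}_{i=0}^d; A^*; \{E^*_i\}_{i=0}^d)$ is a Leonard system on $V$.
   Context: $\mathrm{End}(V)$ is the $\mathbb{F}$-algebra of $\mathbb{F}$-linear maps $V\to V$; $\mathrm{tr}$ means trace. An antiautomorphism of an algebra $\mathcal{A}$ is an $\mathbb{F}$-linear bijection $\tau:\mathcal{A}\to\mathcal{A}$ with $(YZ)^\tau = Z^\tau Y^\tau$ for all $Y,Z$. System of mutually orthogonal rank 1 idempotents in $\mathrm{End}(V)$: a sequence $\{E_i\}_{i=0}^d$ in $\mathrm{End}(V)$ with $E_iE_j=\delta_{i,j}E_i$ and $\mathrm{rank}(E_i)=1$ $(0\le i,j\le d)$. Idempotent system on $V$: a sequence $\Phi=(\{E_i\}_{i=0}^d;\{E^*_i\}_{i=0}^d)$ such that (i) $\{E_i\}_{i=0}^d$ and (ii) $\{E^*_i\}_{i=0}^d$ are systems of mutually orthogonal rank 1 idempotents in $\mathrm{End}(V)$; (iii) $E_0E^*_iE_0\ne 0$ $(0\le i\le d)$; (iv) $E^*_0E_iE^*_0\neq 0$ $(0\le i\le d)$.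 It is symmetric if there is an antiautomorphism $\dagger$ of $\mathrm{End}(V)$ fixing each $E_i$ and each $E^*_i$. For a symmetric idempotent system $\Phi$: $\mathcal{M}$ (resp. $\mathcal{M}^*$) is the subalgebra of $\mathrm{End}(V)$ generated by $\{E_i\}_{i=0}^d$ (resp. $\{E^*_i\}_{i=0}^d$), and these elements form a basis of it. $\nu=\mathrm{tr}(E_0E^*_0)^{-1}$ (this trace is nonzero). $\rho:\mathcal{M}\to\mathcal{M}^*$ is the unique $\mathbb{F}$-linear map with $YE^*_0E_0=Y^\rho E_0$ for all $Y\in\mathcal{M}$; $\rho^*:\mathcal{M}^*\to\mathcal{M}$ is the unique $\mathbb{F}$-linear map with $ZE_0E^*_0=Z^{\rho^*}E^*_0$ for all $Z\in\mathcal{M}^*$. For $0\le i\le d$ put $A_i=\nu(E^*_i)^{\rho^*}\in\mathcal{M}$ and $A^*_i=\nu(E_i)^{\rho}\in\mathcal{M}^*$. The $\{A_i\}_{i=0}^d$ form a basis of $\mathcal{M}$ and the $\{A^*_i\}_{i=0}^d$ a basis of $\mathcal{M}^*$. Scalars $p^h_{ij},q^h_{ij}\in\mathbb{F}$ are defined by $A_iA_j=\sum_{h=0}^d p^h_{ij}A_h$ and $A^*_iA^*_j=\sum_{h=0}^d q^h_{ij}A^*_h$. $\Phi$ is $P$-polynomial (resp. $Q$-polynomial) whenever $p^h_{ij}$ (resp. $q^h_{ij}$) is zero if one of $h,i,j$ is greater than the sum of the other two, and nonzero if one of $h,i,j$ is equal to the sum of the other two $(0\le h,i,j\le d)$. Leonard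 systems: A square matrix $M$ indexed by $0,\dots,d$ is tridiagonal if $M_{i,j}=0$ whenever $|i-j|>1$, and irreducible tridiagonal if moreover $M_{i,j}\ne 0$ whenever $|i-j|=1$. A matrix $M$ represents $A\in\mathrm{End}(V)$ with respect to a basis $\{v_i\}_{i=0}^d$ if $Av_j=\sum_i M_{i,j}v_i$ for all $j$. A Leonard pair on $V$ is an ordered pair $A,A^*$ in $\mathrm{End}(V)$ such that (i) there is a basis of $V$ with respect to which the matrix representing $A$ is irreducible tridiagonal and the matrix representing $A^*$ is diagonal; (ii) there is a basis of $V$ with respect to which the matrix representing $A^*$ is irreducible tridiagonal and the matrix representing $A$ is diagonal. For a Leonard pair $A,A^*$, each of $A,A^*$ is multiplicity-free (diagonalizable with all eigenspaces of dimension one). The primitive idempotents of a multiplicity-free $A$, for an ordering $\{V_i\}_{i=0}^d$ of its eigenspaces, are the $E_i\in\mathrm{End}(V)$ with $(E_i-I)V_i=0$ and $E_iV_j=0$ for $j\ne i$. An ordering $\{E_i\}_{i=0}^d$ of the primitive idempotents of $A$ is standard if, for nonzero $v_i\in E_iV$, the basis $\{v_i\}_{i=0}^d$ satisfies (ii). An ordering $\{E^*_i\}_{i=0}^d$ of the primitive idempotents of $A^*$ is standard if, for nonzero $v_i\in E^*_iV$, the basis $\{v_i\}_{i=0}^d$ satisfies (i). A Leonard system on $V$ is a sequence $(A;\{E_i\}_{i=0}^d;A^*;\{E^*_i\}_{i=0}^d)$ of elements in $\mathrm{End}(V)$ such that $A,A^*$ is a Leonard pair on $V$, $\{E_i\}_{i=0}^d$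 is a standard ordering of the primitive idempotents of $A$, and $\{E^*_i\}_{i=0}^d$ is a standard ordering of the primitive idempotents of $A^*$. *)

(* Defs.v *)
From HB Require Import structures.
From mathcomp Require Import all_boot all_order all_algebra.
From mathcomp Require Import boolp classical_sets.

Set Implicit Arguments.
Unset Strict Implicit.
Unset Printing Implicit Defensive.

Import GRing.Theory.
Local Open Scope ring_scope.

Section IdempotentSystems.

Variables (F : fieldType) (V : vectType F).

(* Matrices in the vector library act on row vectors; since the trace is
   invariant under transposition, this is the usual trace of X. *)
Definition lftrace (X : 'End(V)) : F :=
  \tr (passmx.mxof (vbasis {:V}) (vbasis {:V}) X).

Definition antiautomorphism (tau : {linear 'End(V) -> 'End(V)}) : Prop :=
  bijective tau /\ forall Y Z : 'End(V), tau (Y \o Z)%VF = (tau Z \o tau Y)%VF.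

(* 'End(V) carries no canonical ring structure for a general V : vectType F,
   so subalgebras are described directly, with composition as the product. *)
Definition is_subalgebra (U : {vspace 'End(V)}) : Prop :=
  \1%VF \in U /\ forall X Y, X \in U -> Y \in U -> (X \o Y)%VF \in U.

Definition is_generated_subalgebra n (X : 'I_n -> 'End(V))
    (U : {vspace 'End(V)}) : Prop :=
  [/\ is_subalgebra U, (forall i, X i \in U)
    & forall W : {vspace 'End(V)},
        is_subalgebra W -> (forall i, X i \in W) -> (U <= W)%VS].

Definition generated_subalgebra n (X : 'I_n -> 'End(V)) : {vspace 'End(V)} :=
  xget fullv [set U | is_generated_subalgebra X U]%classic.

Lemma generated_subalgebraP n (X : 'I_n -> 'End(V)) :
  is_generated_subalgebra X (generated_subalgebra X).
Proof.
apply: (@xgetPex _ fullv [set U | is_generated_subalgebra X U]%classic).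
pose P m := `[< exists U : {vspace 'End(V)},
  [/\ is_subalgebra U, forall i, X i \in U & \dim U = m] >].
have exP : exists m, P m.
  exists (\dim (fullv : {vspace 'End(V)})); apply/asboolP; exists fullv.
  by split=> // [|i]; [split=> [|*]|]; rewrite memvf.
case: (ex_minnP exP) => m /asboolP[U [sU XU dU]] minU.
exists U; split=> // W [W1 WM] XW.
have [U1 UM] := sU.
have : P (\dim (U :&: W)%VS).
  apply/asboolP; exists (U :&: W)%VS; split=> //; last first.
    by move=> i; rewrite memv_cap XU XW.
  split; first by rewrite memv_cap U1 W1.
  move=> Y Z; rewrite !memv_cap => /andP[YU YW] /andP[ZU ZW].
  by rewrite UM ?WM.
move/minU; rewrite -dU => le_dim.
have /eqP <- : (U :&: W)%VS == U by rewrite eqEdim capvSl.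
exact: capvSr.
Qed.

Variable d : nat.
Implicit Types X Y E Es : 'I_d.+1 -> 'End(V).

Definition orthogonal_rank1_idempotents X : Prop :=
  (forall i j, (X i \o X j)%VF = if i == j then X i else 0)
  /\ forall i, \dim (limg (X i)) = 1%N.

Definition idempotent_system E Es : Prop :=
  [/\ orthogonal_rank1_idempotents E,
      orthogonal_rank1_idempotents Es,
      forall i, (E ord0 \o Es i \o E ord0)%VF != 0
    & forall i, (Es ord0 \o E i \o Es ord0)%VF != 0].

Definition symmetric_idempotent_system E Es : Prop :=
  idempotent_system E Es /\
  exists2 dagger : {linear 'End(V) -> 'End(V)}, antiautomorphism dagger
    & (forall i, dagger (E i) = E i) /\ (forall i, dagger (Es i) = Es i).

Definition nu E Es : F := (lftrace (E ord0 \o Es ord0)%VF)^-1.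

Definition is_rho E Es
    (r : 'Hom(subvs_of (generated_subalgebra E),
              subvs_of (generated_subalgebra Es))) : Prop :=
  forall Y : subvs_of (generated_subalgebra E),
    (vsval Y \o Es ord0 \o E ord0)%VF = (vsval (r Y) \o E ord0)%VF.

(* rho E Es is the map from M to M^*; the map from M^* to M is rho Es E. *)
Definition rho E Es : 'Hom(subvs_of (generated_subalgebra E),
                           subvs_of (generated_subalgebra Es)) :=
  xget 0 [set r | is_rho r]%classic.

Lemma rho_unique E Es : \dim {:V} = d.+1 -> idempotent_system E Es ->
  is_rho (rho E Es) /\ forall r, is_rho r -> r = rho E Es.
Proof.
move=> dV [[EE rkE] [EsEs rkEs] E0Es _].
have nzE0 : limg (E ord0) != 0%VS by rewrite -dimv_eq0 rkE.
pose u := vpick (limg (E ord0)).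
have nzu : u != 0 by rewrite vpick0.
have limE0 : limg (E ord0) = <[u]>%VS.
  apply/esym/eqP; rewrite eqEdim dim_vline nzu rkE andbT.
  by rewrite -memvE memv_pick.
have compE0 (X : 'End(V)) : (X u = 0) -> (X \o E ord0)%VF = 0.
  move=> Xu; apply/lfunP => w; rewrite comp_lfunE lfunE /=.
  have : E ord0 w \in <[u]>%VS by rewrite -limE0 memv_img ?memvf.
  by case/vlineP=> k ->; rewrite linearZ /= Xu scaler0.
have E0u : E ord0 u = u.
  have /memv_imgP[w _ ->] : u \in limg (E ord0) by rewrite memv_pick.
  by rewrite -comp_lfunE EE eqxx.
have nzEsu i : Es i u != 0.
  apply: contraNneq (E0Es i) => Eu0.
  by rewrite -comp_lfunA compE0 ?comp_lfun0r.
pose b := [tuple Es i u | i < d.+1].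
have bE (i : 'I_d.+1) : b`_i = Es i u by rewrite -(tnth_nth 0) tnth_mktuple.
have freeb : free b.
  apply/freeP => k sum0 i; apply/eqP.
  have := congr1 (Es i) sum0; rewrite linear0 linear_sum (bigD1 i) //=.
  rewrite big1 => [|j ji]; rewrite bE linearZ /= -comp_lfunE EsEs.
    by rewrite eqxx addr0 => /eqP; rewrite scaler_eq0 (negPf (nzEsu i)) orbF.
  by rewrite eq_sym (negPf ji) lfunE scaler0.
have basisb : basis_of {:V} b.
  by rewrite basisEfree freeb subvf size_tuple dV leqnn.
have sumEs : \sum_i Es i = \1%VF.
  apply/lfunP => w; rewrite (coord_basis basisb (memvf w)) !linear_sum /=.
  apply: eq_bigr => j _; rewrite !linearZ /= bE lfunE /= sum_lfunE (bigD1 j) //=.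
  rewrite big1 => [|i ij]; rewrite -comp_lfunE EsEs ?eqxx ?addr0 //.
  by rewrite (negPf ij) lfunE.
pose S := <<[tuple Es i | i < d.+1]>>%VS.
have EsS i : Es i \in S.
  by apply: memv_span; apply/mapP; exists i; rewrite ?mem_enum.
have spanS W : W \in S -> exists c : 'I_d.+1 -> F, W = \sum_i c i *: Es i.
  move/coord_span => defW.
  exists (fun i => coord [tuple Es i | i < d.+1] i W); rewrite {1}defW.
  by apply: eq_bigr => i _; rewrite -(tnth_nth 0) tnth_mktuple.
have sM : (generated_subalgebra Es <= S)%VS.
  have [_ _] := generated_subalgebraP Es; apply=> //.
  split; first by rewrite -sumEs rpred_sum.
  move=> W Z /spanS[c ->] /spanS[c' ->].
  have -> : ((\sum_i c i *: Es i) \o (\sum_i c' i *: Es i))%VF =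
            \sum_i (c i * c' i) *: Es i.
    apply/lfunP => w; rewrite comp_lfunE !sum_lfunE; apply: eq_bigr => i _.
    rewrite linear_sum (bigD1 i) //= big1 ?addr0 => [|j ji].
      by rewrite !scale_lfunE !linearZ /= -comp_lfunE EsEs eqxx scalerA mulrC.
    rewrite !scale_lfunE !linearZ /= -comp_lfunE EsEs eq_sym (negPf ji).
    by rewrite lfunE !scaler0.
  by apply: rpred_sum => i _; apply: rpredZ.
pose N := generated_subalgebra Es.
have [_ EsN _] := generated_subalgebraP Es.
have injN Z : Z \in N -> Z u = 0 -> Z = 0.
  move=> /(subvP sM)/spanS[c ->]; rewrite sum_lfunE => Zu.
  rewrite big1 // => i _; have/freeP/(_ c) -> := freeb; first exact: scale0r.
  by rewrite -[RHS]Zu; apply: eq_bigr => j _; rewrite bE scale_lfunE.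
have eqN (r r' : 'Hom(subvs_of (generated_subalgebra E), subvs_of N)) :
    is_rho r -> is_rho r' -> r = r'.
  move=> hr hr'; apply/lfunP => Y; apply/val_inj/eqP; rewrite -subr_eq0.
  apply/eqP/injN; first by rewrite rpredB ?subvsP.
  have := congr1 (fun f : 'End(V) => f u) (hr Y); rewrite (hr' Y) /=.
  by rewrite !comp_lfunE E0u add_lfunE opp_lfunE => ->; rewrite subrr.
pose g (i : 'I_d.+1) : subvs_of N := vsproj N (Es i).
pose f (Y : subvs_of (generated_subalgebra E)) : subvs_of N :=
  \sum_i coord b i (vsval Y (Es ord0 u)) *: g i.
have lf : linear f.
  move=> k Y Z; rewrite /f scaler_sumr -big_split; apply: eq_bigr => i _ /=.
  by rewrite add_lfunE scale_lfunE linearP /= scalerDl scalerA.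
pose flin : {linear _ -> _} :=
  HB.pack f (GRing.isSemilinear.Build _ _ _ _ f (GRing.semilinear_linear lf)).
have rho_f : is_rho (linfun flin).
  move=> Y; rewrite lfunE /=; apply/eqP; rewrite -subr_eq0.
  have -> : ((vsval Y \o Es ord0 \o E ord0) - (vsval (f Y) \o E ord0))%VF =
            (((vsval Y \o Es ord0) - vsval (f Y)) \o E ord0)%VF.
    by rewrite comp_lfunDl comp_lfunNl.
  apply/eqP/compE0; rewrite add_lfunE opp_lfunE comp_lfunE.
  apply/eqP; rewrite subr_eq0 {1}(coord_basis basisb (memvf (vsval Y _))).
  apply/eqP; rewrite /f linear_sum sum_lfunE; apply: eq_bigr => i _ /=.
  by rewrite scale_lfunE bE vsprojK.
have rhoP : is_rho (rho E Es).
  by apply: (@xgetPex _ 0 [set r | is_rho r]%classic); exists (linfun flin).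
by split=> // r hr; apply: eqN.
Qed.

Definition A_ E Es (i : 'I_d.+1) : 'End(V) :=
  nu E Es *: vsval (rho Es E (vsproj (generated_subalgebra Es) (Es i))).

Definition As_ E Es (i : 'I_d.+1) : 'End(V) :=
  nu E Es *: vsval (rho E Es (vsproj (generated_subalgebra E) (E i))).

(* The coefficient of X h in X i X j, when X is a basis of a subalgebra. *)
Definition structure_constant X (h i j : 'I_d.+1) : F :=
  coord [tuple X k | k < d.+1] h (X i \o X j)%VF.

Definition triangular_constants (c : 'I_d.+1 -> 'I_d.+1 -> 'I_d.+1 -> F) :
    Prop :=
  forall h i j : 'I_d.+1,
    ([|| i + j < h, h + j < i | h + i < j]%N -> c h i j = 0) /\
    ([|| h == i + j :> nat, i == h + j :> nat | j == h + i :> nat]%N ->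
       c h i j != 0).

Definition P_polynomial E Es : Prop :=
  triangular_constants (structure_constant (A_ E Es)).

Definition Q_polynomial E Es : Prop :=
  triangular_constants (structure_constant (As_ E Es)).

Definition represents (v : d.+1.-tuple V) (A : 'End(V)) (M : 'M[F]_d.+1) :
    Prop :=
  forall j, A (tnth v j) = \sum_i M i j *: tnth v i.

Definition tridiagonal (M : 'M[F]_d.+1) : Prop :=
  forall i j : 'I_d.+1, (i.+1 < j)%N || (j.+1 < i)%N -> M i j = 0.

Definition irreducible_tridiagonal (M : 'M[F]_d.+1) : Prop :=
  tridiagonal M /\
  forall i j : 'I_d.+1, (i.+1 == j :> nat) || (j.+1 == i :> nat) -> M i j != 0.

Definition tridiagonal_diagonal_basis (A B : 'End(V)) (v : d.+1.-tuple V) :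
    Prop :=
  basis_of {:V} v /\
  exists MA MB : 'M[F]_d.+1,
    [/\ represents v A MA, irreducible_tridiagonal MA,
        represents v B MB & is_diag_mx MB].

Definition Leonard_pair (A As : 'End(V)) : Prop :=
  (exists v, tridiagonal_diagonal_basis A As v) /\
  (exists v, tridiagonal_diagonal_basis As A v).

(* An ordering of the eigenspaces is given by an ordering theta of the
   eigenvalues, without repetition. *)
Definition primitive_idempotents (A : 'End(V)) X : Prop :=
  exists theta : 'I_d.+1 -> F,
    [/\ injective theta,
        forall a, passmx.leigenvalue A a <-> exists i, a = theta i,
        forall i v, v \in passmx.leigenspace A (theta i) -> (X i - \1)%VF v = 0
      & forall i j v, j != i -> v \in passmx.leigenspace A (theta j) -> X i v = 0].

(* X is a standard ordering of the primitive idempotents of A, for the Leonard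
   pair formed by A and B (in either order). *)
Definition standard_ordering (A B : 'End(V)) X : Prop :=
  primitive_idempotents A X /\
  forall v : d.+1.-tuple V,
    (forall i, tnth v i != 0 /\ tnth v i \in limg (X i)) ->
    tridiagonal_diagonal_basis B A v.

Definition Leonard_system (A : 'End(V)) E (As : 'End(V)) Es : Prop :=
  [/\ Leonard_pair A As, standard_ordering A As E & standard_ordering As A Es].

End IdempotentSystems.

(* Main.v *)
Require Import Defs.
From HB Require Import structures.
From mathcomp Require Import all_boot all_order all_algebra.
From mathcomp Require Import boolp.
From mathcomp Require Import zify ring.

(** Let w span the image of Es_0 and put u_i = Es_i (E_0 w).  The vectors
    E_j w and the vectors u_i are two bases of V, and the definition of
    A_i = A_ E Es i amounts to: A_i lies in the algebra M generated by the E_j,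
    and A_i w = nu u_i.  Elements of M are diagonal in the basis (E_j w), so
    they are determined by their value at w = \sum_j E_j w; therefore the
    products A_i A_j can be read off at w, and p^h_ij is the entry (h, j) of the
    matrix of A_i in the basis (u_i) (structure_constantE).  Exchanging E and Es
    exchanges the P-polynomial and Q-polynomial properties, so only the former
    has to be studied.

    From (i) to (ii): the P-polynomial property for A_1 says that its matrix in
    the basis (u_i) is irreducible tridiagonal.  It is diagonal in the basis
    (E_j w), and its eigenvalues are distinct because an eigenvector of an
    irreducible tridiagonal matrix is determined by its first coordinate.
    Together with the dual statement, A_1 and its dual As_1 complete (E, Es) to
    a Leonard system; for d = 0 one takes A = As = 0.

    From (ii) to (i): in an eigenbasis of As, a diagonal rescaling symmetrizes
    the irreducible tridiagonal matrix of A, and the corresponding weighted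
    transpose is an antiautomorphism fixing A and the Es_i, hence also the E_i.
    An eigenvector in the image of E_0 is cyclic for As, so Es_i E_0 is not
    zero; applying the antiautomorphism and comparing ranks, E_0 Es_i E_0 is not
    zero either.  Let B be the matrix of A in the basis (u_i) and L_i that of
    A_i.  Then B L_i = \sum_h B_hi L_h and L_0 is a nonzero scalar, so L_i is
    in effect a polynomial of degree exactly i in B: it is a band matrix whose
    i-th off-diagonals have no zero (tridiagonal_band).  This gives
    the conditions on p^h_ij where h or j is the largest index, and the case of
    i follows from p^h_ij = p^h_ji, as M is commutative. *)

Set Implicit Arguments.
Unset Strict Implicit.
Unset Printing Implicit Defensive.

Import GRing.Theory.
Local Open Scope ring_scope.

(** * Coordinates and matrices in a basis *)

Section Bases.

Variables (F : fieldType) (V : vectType F).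

Section OneBasis.

Variables (n : nat) (v : n.-tuple V).
Hypothesis bv : basis_of {:V} v.

Lemma basis_expansion x : x = \sum_i coord v i x *: tnth v i.
Proof.
rewrite {1}(coord_basis bv (memvf x)).
by apply: eq_bigr => i _; rewrite -tnth_nth.
Qed.

Lemma coord_tnth i j : coord v i (tnth v j) = (j == i)%:R.
Proof. by rewrite (tnth_nth 0) coord_free ?(basis_free bv). Qed.

Lemma coord_sum_tnth (c : 'I_n -> F) i :
  coord v i (\sum_j c j *: tnth v j) = c i.
Proof.
rewrite linear_sum (bigD1 i) //= big1 => [|j /negPf ji].
  by rewrite linearZ /= coord_tnth eqxx mulr1 addr0.
by rewrite linearZ /= coord_tnth ji mulr0.
Qed.

Lemma tnth_basis_neq0 j : tnth v j != 0.
Proof.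
apply/eqP => v0; have := coord_tnth j j.
by rewrite v0 linear0 eqxx => /esym/eqP; rewrite oner_eq0.
Qed.

Lemma lfun_basisP (U : vectType F) (X Y : 'Hom(V, U)) :
  (forall j, X (tnth v j) = Y (tnth v j)) -> X = Y.
Proof.
move=> XY; apply/lfunP => x; rewrite (basis_expansion x) !linear_sum.
by apply: eq_bigr => j _; rewrite !linearZ /= XY.
Qed.

Definition lfmx (X : 'End(V)) : 'M[F]_n :=
  \matrix_(i, j) coord v i (X (tnth v j)).

Fact lfmx_is_linear : linear lfmx.
Proof.
move=> a X Y; apply/matrixP => i j.
by rewrite !mxE add_lfunE scale_lfunE linearP.
Qed.
HB.instance Definition _ := GRing.isSemilinear.Build F _ _ _ lfmx
  (GRing.semilinear_linear lfmx_is_linear).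

(** Mapping x to \sum_i (\sum_j M i j x_j) v_i, so that M acts on columns of
    coordinates, as in represents. *)
Definition mx_app (M : 'M[F]_n) (x : V) : V :=
  \sum_i (\sum_j M i j * coord v j x) *: tnth v i.

Fact mx_app_is_linear M : linear (mx_app M).
Proof.
move=> a x y; rewrite /mx_app scaler_sumr -big_split /=.
apply: eq_bigr => i _; rewrite scalerA -scalerDl mulr_sumr -big_split /=.
by congr (_ *: _); apply: eq_bigr => j _; rewrite linearP mulrDr mulrCA.
Qed.
HB.instance Definition _ M := GRing.isSemilinear.Build F _ _ _ (mx_app M)
  (GRing.semilinear_linear (mx_app_is_linear M)).

Definition mxlf (M : 'M[F]_n) : 'End(V) := linfun (mx_app M).

Lemma mxlf_tnth M j : mxlf M (tnth v j) = \sum_i M i j *: tnth v i.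
Proof.
rewrite lfunE /=; apply: eq_bigr => i _; congr (_ *: _).
rewrite (bigD1 j) //= big1 => [|k /negPf kj]; rewrite coord_tnth.
  by rewrite eqxx mulr1 addr0.
by rewrite eq_sym kj mulr0.
Qed.

Fact mxlf_is_linear : linear mxlf.
Proof.
move=> a M N; apply/lfunP => x; rewrite add_lfunE scale_lfunE !lfunE /=.
rewrite /mx_app scaler_sumr -big_split /=; apply: eq_bigr => i _.
rewrite scalerA -scalerDl mulr_sumr -big_split /=; congr (_ *: _).
by apply: eq_bigr => j _; rewrite !mxE mulrDl mulrA.
Qed.

HB.instance Definition _ := GRing.isSemilinear.Build F _ _ _ mxlf
  (GRing.semilinear_linear mxlf_is_linear).

Lemma lfmx_tnth (X : 'End(V)) j : X (tnth v j) = \sum_i lfmx X i j *: tnth v i.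
Proof.
by rewrite {1}(basis_expansion (X _)); apply: eq_bigr => i _; rewrite mxE.
Qed.

Lemma lfmxK : cancel lfmx mxlf.
Proof. by move=> X; apply: lfun_basisP => j; rewrite mxlf_tnth -lfmx_tnth. Qed.

Lemma mxlfK : cancel mxlf lfmx.
Proof.
by move=> M; apply/matrixP => i j; rewrite mxE mxlf_tnth coord_sum_tnth.
Qed.

Lemma lfmx_comp (X Y : 'End(V)) : lfmx (X \o Y)%VF = lfmx X *m lfmx Y.
Proof.
apply/matrixP => i j; rewrite !mxE comp_lfunE (lfmx_tnth Y) !linear_sum.
by apply: eq_bigr => k _; rewrite !linearZ /= mulrC !mxE.
Qed.

End OneBasis.

(** Expanding X through both bases turns one trace into the other. *)
Lemma sum_coord_basis_indep m n (e : m.-tuple V) (f : n.-tuple V)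
    (X : 'End(V)) :
  basis_of {:V} e -> basis_of {:V} f ->
  \sum_i coord e i (X (tnth e i)) = \sum_j coord f j (X (tnth f j)).
Proof.
move=> be bf.
transitivity (\sum_i \sum_j
    coord f j (X (tnth e i)) * coord e i (tnth f j)).
  apply: eq_bigr => i _; rewrite {1}(basis_expansion bf (X _)) linear_sum.
  by apply: eq_bigr => j _; rewrite linearZ.
rewrite exchange_big; apply: eq_bigr => j _ /=.
rewrite {2}(basis_expansion be (tnth f j)) !linear_sum.
by apply: eq_bigr => i _; rewrite !linearZ /= mulrC.
Qed.

Lemma lftraceE n (v : n.-tuple V) (X : 'End(V)) : basis_of {:V} v ->
  lftrace X = \sum_i coord v i (X (tnth v i)).
Proof.
move=> bv; rewrite (sum_coord_basis_indep _ bv (vbasisP _)) /lftrace /mxtrace.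
apply: eq_bigr => i _.
by rewrite !mxE /= passmx.vecof_delta -tnth_nth.
Qed.

End Bases.

(** * Bases adapted to orthogonal idempotents *)

Section AdaptedBases.

Variables (F : fieldType) (V : vectType F) (d : nat).
Hypothesis dimV : \dim {:V} = d.+1.
Implicit Types (X E Es : 'I_d.+1 -> 'End(V)) (v w : d.+1.-tuple V).

Definition adapted X v : Prop :=
  basis_of {:V} v /\
  forall i j, X i (tnth v j) = if i == j then tnth v j else 0.

Lemma adapted_intro X v :
  (forall j, tnth v j != 0) ->
  (forall i j, X i (tnth v j) = if i == j then tnth v j else 0) ->
  adapted X v.
Proof.
move=> v0 Xv; split=> //.
rewrite basisEfree subvf size_tuple dimV leqnn andbT andbT.
apply/freeP => k sum0 i; apply/eqP; have := congr1 (X i) sum0.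
rewrite linear0 linear_sum (bigD1 i) //= big1 => [|j /negPf ji].
  rewrite -tnth_nth linearZ /= Xv eqxx addr0 => /eqP.
  by rewrite scaler_eq0 (negPf (v0 i)) orbF.
by rewrite -tnth_nth linearZ /= Xv eq_sym ji scaler0.
Qed.

Lemma adapted_limg X v i : adapted X v -> limg (X i) = <[tnth v i]>%VS.
Proof.
case=> bv Xv; apply/vspaceP => x; apply/idP/idP => [/memv_imgP[y _ ->]|].
  rewrite (basis_expansion bv y) linear_sum (bigD1 i) //=.
  rewrite big1 => [|j /negPf ji].
    by rewrite linearZ /= Xv eqxx addr0 memvZ // memv_line.
  by rewrite linearZ /= Xv eq_sym ji scaler0.
case/vlineP => k ->; apply: memvZ.
by have := Xv i i; rewrite eqxx => <-; rewrite memv_img ?memvf.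
Qed.

Lemma adapted_orthogonal X v :
  adapted X v -> orthogonal_rank1_idempotents X.
Proof.
move=> aX; have [bv Xv] := aX; split=> [i j|i]; last first.
  by rewrite (adapted_limg _ aX) dim_vline (tnth_basis_neq0 bv).
apply: (lfun_basisP bv) => k; rewrite comp_lfunE (Xv j k).
have [<-|nij] := eqVneq i j; first by case: ifP; rewrite ?linear0 ?Xv // => ->.
rewrite lfunE /=; have [<-|_] := eqVneq j k; last exact: linear0.
by rewrite Xv (negPf nij).
Qed.

Lemma orthogonal_adapted X :
  orthogonal_rank1_idempotents X -> exists v, adapted X v.
Proof.
case=> XX rkX; pose v := [tuple vpick (limg (X i)) | i < d.+1].
have Xpick i : X i (vpick (limg (X i))) = vpick (limg (X i)).
  have /memv_imgP[y _ ->] := memv_pick (limg (X i)).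
  by rewrite -comp_lfunE XX eqxx.
exists v; apply: adapted_intro => [j|i j]; rewrite !tnth_mktuple.
  by rewrite vpick0 -dimv_eq0 rkX.
have [->//|nij] := eqVneq i j.
by rewrite -{1}Xpick -comp_lfunE XX (negPf nij) lfunE.
Qed.

(** Each image is a line, so the choice of a basis adapted to X only matters up
    to scaling; this is why standard_ordering can quantify over all of them. *)
Lemma adapted_rescale X v w : adapted X v ->
  (forall i, tnth w i != 0 /\ tnth w i \in limg (X i)) ->
  adapted X w /\
  exists k : 'I_d.+1 -> F,
    (forall i, k i != 0) /\ forall i, tnth w i = k i *: tnth v i.
Proof.
move=> aX wX; have [bv Xv] := aX.
have /choice[k kE] i : exists c, tnth w i = c *: tnth v i.
  by have [_] := wX i; rewrite (adapted_limg _ aX) => /vlineP.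
split; last first.
  exists k; split=> // i; apply/negP => /eqP k0; have [/negP[]] := wX i.
  by rewrite kE k0 scale0r.
apply: adapted_intro => [j|i j]; first by have [] := wX j.
by rewrite kE linearZ /= Xv; case: ifP => // _; rewrite scaler0.
Qed.

Lemma mem_limg_adapted X v i : adapted X v ->
  tnth v i != 0 /\ tnth v i \in limg (X i).
Proof.
move=> aX; rewrite (adapted_limg _ aX) memv_line; split=> //.
by case: aX => bv _; apply: tnth_basis_neq0.
Qed.

Lemma adapted_sum X v : adapted X v -> \sum_i X i = \1%VF.
Proof.
case=> bv Xv; apply: (lfun_basisP bv) => j.
rewrite sum_lfunE id_lfunE (bigD1 j) //= big1 => [|i /negPf ij].
  by rewrite Xv eqxx addr0.
by rewrite Xv ij.
Qed.

(** The span of the X i is already closed under composition, since it consists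
   of the maps that are diagonal in an adapted basis. *)
Lemma mem_generated_subalgebraP X v Y : adapted X v ->
  Y \in generated_subalgebra X <->
  exists c : 'I_d.+1 -> F, forall j, Y (tnth v j) = c j *: tnth v j.
Proof.
move=> aX; have [bv Xv] := aX.
have combE (c : 'I_d.+1 -> F) j :
    (\sum_i c i *: X i) (tnth v j) = c j *: tnth v j.
  rewrite sum_lfunE (bigD1 j) //= big1 => [|i /negPf ij].
    by rewrite scale_lfunE Xv eqxx addr0.
  by rewrite scale_lfunE Xv ij scaler0.
have combP (Z : 'End(V)) (c : 'I_d.+1 -> F) :
    (forall j, Z (tnth v j) = c j *: tnth v j) -> Z = \sum_i c i *: X i.
  by move=> Zc; apply: (lfun_basisP bv) => j; rewrite combE Zc.
pose S := <<[tuple X i | i < d.+1]>>%VS.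
have XS i : X i \in S.
  by apply: memv_span; apply/mapP; exists i; rewrite ?mem_enum.
have SP (Z : 'End(V)) : Z \in S <->
    exists c : 'I_d.+1 -> F, forall j, Z (tnth v j) = c j *: tnth v j.
  split=> [/coord_span|[c /combP ->]]; last first.
    by rewrite rpred_sum => // i _; rewrite rpredZ.
  move=> defZ; exists (fun i => coord [tuple X i | i < d.+1] i Z) => j.
  rewrite -[RHS](combE (fun i => coord [tuple X i | i < d.+1] i Z)) {1}defZ.
  congr (fun_of_lfun _ _); apply: eq_bigr => i _.
  by rewrite -tnth_nth tnth_mktuple.
have [[_ genM] Xgen gen_min] := generated_subalgebraP X.
split=> [|[c /combP ->]]; last by rewrite rpred_sum => // i _; rewrite rpredZ.
have sS : is_subalgebra S.
  split; first by rewrite -(adapted_sum aX) rpred_sum.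
  move=> Y1 Y2 /SP[c1 Yc1] /SP[c2 Yc2]; apply/SP.
  exists (fun j => c2 j * c1 j) => j.
  by rewrite comp_lfunE Yc2 linearZ /= Yc1 scalerA.
by move/(subvP (gen_min _ sS XS))/SP.
Qed.

End AdaptedBases.

(** * Leonard systems through adapted bases *)

Section LeonardBases.

Variables (F : fieldType) (V : vectType F) (d : nat).
Implicit Types (A B : 'End(V)) (X E Es : 'I_d.+1 -> 'End(V)).
Implicit Types (v w : d.+1.-tuple V) (M : 'M[F]_d.+1).

(** What one basis has to satisfy to carry half of a Leonard system. *)
Definition diagonal_tridiagonal A B X v : Prop :=
  [/\ adapted X v,
      (exists2 theta : 'I_d.+1 -> F, injective theta
        & forall j, A (tnth v j) = theta j *: tnth v j)
    & exists2 M, represents v B M & irreducible_tridiagonal M].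

Lemma irreducible_tridiagonal_rescale v w B M (k : 'I_d.+1 -> F) :
  (forall i, k i != 0) -> (forall i, tnth w i = k i *: tnth v i) ->
  represents v B M -> irreducible_tridiagonal M ->
  exists2 M', represents w B M' & irreducible_tridiagonal M'.
Proof.
move=> k0 wv vM [tM iM]; exists (\matrix_(i, j) (k j * M i j / k i)).
  move=> j; rewrite wv linearZ /= vM scaler_sumr; apply: eq_bigr => i _.
  by rewrite mxE wv !scalerA divfK.
split=> i j ij; rewrite mxE; first by rewrite tM // mulr0 mul0r.
by rewrite !mulf_neq0 ?invr_eq0 // iM.
Qed.

(** An eigenvector of an irreducible tridiagonal map is determined by its first
   coordinate: the three-term recurrence gives the other ones. *)
Lemma tridiagonal_eigenvector_eq0 v B M a x : basis_of {:V} v ->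
  represents v B M -> irreducible_tridiagonal M ->
  B x = a *: x -> coord v ord0 x = 0 -> x = 0.
Proof.
move=> bv vM [tM iM] Bx x0.
have rec i : \sum_j M i j * coord v j x = a * coord v i x.
  have := congr1 (coord v i) Bx; rewrite linearZ /= => <-.
  rewrite {2}(basis_expansion bv x) !linear_sum; apply: eq_bigr => j _ /=.
  by rewrite !linearZ /= vM coord_sum_tnth // mulrC.
have c0 n : (n <= d)%N -> forall j : 'I_d.+1, (j <= n)%N -> coord v j x = 0.
  elim: n => [|n IHn] n_d j.
    rewrite leqn0 => /eqP j0; rewrite -[RHS]x0; congr (coord v _ x).
    exact: val_inj.
  rewrite leq_eqVlt => /orP[/eqP jn|/IHn]; last by apply; apply: ltnW.
  have i_d : (n < d.+1)%N by lia.
  pose i := Ordinal i_d.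
  have := rec i; rewrite (IHn _ i) ?(ltnW n_d) // mulr0 (bigD1 j) //= big1.
    move/eqP; rewrite addr0 mulf_eq0 => /orP[/negPn|/eqP //].
    by rewrite iM //= jn eqxx.
  move=> k kj; have [kn|nk] := leqP k n; first by rewrite IHn ?mulr0 // ltnW.
  rewrite tM ?mul0r //=; apply/orP; left.
  by rewrite -jn; have : (k != j :> nat) := kj; lia.
rewrite (basis_expansion bv x) big1 // => j _.
by rewrite (c0 d) ?scale0r // -ltnS.
Qed.

(** Two eigenvectors for the same eigenvalue would have a nontrivial combination
    with vanishing first coordinate. *)
Lemma tridiagonal_eigenvalues_inj v w B M (theta : 'I_d.+1 -> F) :
  basis_of {:V} v -> basis_of {:V} w ->
  represents v B M -> irreducible_tridiagonal M ->
  (forall j, B (tnth w j) = theta j *: tnth w j) -> injective theta.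
Proof.
move=> bv bw vM iM Bw j k thjk; apply/eqP/negPn/negP => jk.
pose c i := coord v ord0 (tnth w i).
pose x := c k *: tnth w j - c j *: tnth w k.
have x0 : x = 0.
  apply: (tridiagonal_eigenvector_eq0 bv vM iM (a := theta j)).
    rewrite linearB !linearZ /= !Bw -thjk scalerN scalerBr !scalerA.
    by congr (_ *: _ - _ *: _); apply: mulrC.
  by rewrite linearB !linearZ /= mulrC subrr.
have ck : c k = 0.
  have := congr1 (coord w j) x0; rewrite linearB !linearZ /= linear0.
  by rewrite !coord_tnth // eqxx eq_sym (negPf jk) mulr1 mulr0 subr0.
have wk0 := tridiagonal_eigenvector_eq0 bv vM iM (Bw k) ck.
by have := tnth_basis_neq0 bw k; rewrite wk0 eqxx.
Qed.

Hypothesis dimV : \dim {:V} = d.+1.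

(** Eigenvectors of A for distinct eigenvalues form an adapted basis, and
    conversely a single suitable basis suffices, since rescaling its vectors
    keeps an irreducible tridiagonal matrix irreducible tridiagonal. *)
Lemma standard_orderingP A B X :
  standard_ordering A B X <-> exists v, diagonal_tridiagonal A B X v.
Proof.
split=> [[[th [th_inj thE X1 X0]] stdX]|[v [aX [th th_inj Av] [M vM iM]]]].
  pose v := [tuple vpick (passmx.leigenspace A (th i)) | i < d.+1].
  have vE i : tnth v i \in passmx.leigenspace A (th i).
    by rewrite tnth_mktuple memv_pick.
  have aX : adapted X v.
    apply: adapted_intro => // [j|i j].
      by rewrite tnth_mktuple vpick0; apply/thE; exists j.
    have [->|nij] := eqVneq i j; last by apply: X0 (vE j); rewrite eq_sym.
    have /eqP := X1 j _ (vE j).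
    by rewrite add_lfunE opp_lfunE id_lfunE subr_eq0 => /eqP.
  exists v; split=> //.
    exists th => // j; have := vE j; rewrite memv_ker add_lfunE opp_lfunE.
    by rewrite scale_lfunE id_lfunE subr_eq0 => /eqP.
  have [_ [M [_ [vM iM _ _]]]] := stdX v (fun i => mem_limg_adapted i aX).
  by exists M.
have [bv Xv] := aX.
have eigP a x : x \in passmx.leigenspace A a ->
    forall j, (th j - a) * coord v j x = 0.
  rewrite memv_ker add_lfunE opp_lfunE scale_lfunE id_lfunE => /eqP Ax j.
  have := congr1 (coord v j) Ax; rewrite linear0 linearB linearZ /= => <-.
  rewrite mulrBl; congr (_ - _).
  rewrite {2}(basis_expansion bv x) linear_sum /=.
  have -> : \sum_i A (coord v i x *: tnth v i) =
            \sum_i (th i * coord v i x) *: tnth v i.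
    by apply: eq_bigr => i _; rewrite linearZ /= Av scalerA mulrC.
  by rewrite coord_sum_tnth.
have mem_eig j : tnth v j \in passmx.leigenspace A (th j).
  by rewrite memv_ker add_lfunE opp_lfunE scale_lfunE id_lfunE Av subrr.
have eig_line i x : x \in passmx.leigenspace A (th i) ->
    x = coord v i x *: tnth v i.
  move=> /eigP xE; rewrite {1}(basis_expansion bv x) (bigD1 i) //=.
  rewrite big1 ?addr0 // => j ji; have /eqP := xE j.
  rewrite mulf_eq0 subr_eq0 (inj_eq th_inj) (negPf ji) => /eqP ->.
  by rewrite scale0r.
split.
  exists th; split=> //.
  - move=> a; split=> [|[i ->]]; last first.
      apply/negP => /eqP e0; have := mem_eig i.
      by rewrite e0 memv0 (negPf (tnth_basis_neq0 bv i)).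
    rewrite /passmx.leigenvalue -vpick0 => nz0.
    have pE := eigP a _ (memv_pick _).
    apply: contrapT => nth; case/negP: nz0; apply/eqP.
    rewrite (basis_expansion bv (vpick _)) big1 // => j _.
    have /eqP := pE j; rewrite mulf_eq0 subr_eq0 => /orP[/eqP th_a|/eqP ->].
      by case: nth; exists j.
    by rewrite scale0r.
  - move=> i x /eig_line ->.
    rewrite linearZ /= add_lfunE opp_lfunE id_lfunE Xv eqxx subrr.
    exact: scaler0.
  move=> i j x ji /eig_line ->; rewrite linearZ /= Xv eq_sym (negPf ji).
  exact: scaler0.
move=> w wX; have [[bw _] [k [k0 wv]]] := adapted_rescale dimV aX wX.
have [M' wM' iM'] := irreducible_tridiagonal_rescale k0 wv vM iM.
split=> //; exists M', (diag_mx (\row_i th i)); split=> // j.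
rewrite (bigD1 j) //= big1 => [|i /negPf ij].
  by rewrite !mxE eqxx mulr1n addr0 wv linearZ /= Av !scalerA mulrC.
by rewrite !mxE ij mulr0n scale0r.
Qed.

(** The Leonard pair condition follows from the two standard orderings, because
    adapted bases exist. *)
Lemma Leonard_systemP A E As Es :
  Leonard_system A E As Es <->
  (exists v, diagonal_tridiagonal A As E v) /\
  (exists vs, diagonal_tridiagonal As A Es vs).
Proof.
split=> [[_ /standard_orderingP hE /standard_orderingP hEs] //|[hE hEs]].
have /standard_orderingP sE := hE; have /standard_orderingP sEs := hEs.
have [v [aE _ _]] := hE; have [w [aEs _ _]] := hEs.
split=> //; split.
  by exists w; case: sEs => _; apply=> i; apply: mem_limg_adapted aEs.
by exists v; case: sE => _; apply=> i; apply: mem_limg_adapted aE.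
Qed.

End LeonardBases.

(** * Structure constants of an idempotent system *)

Section IdempotentSystems.

Variables (F : fieldType) (V : vectType F) (d : nat).
Hypothesis dimV : \dim {:V} = d.+1.
Implicit Types (E Es : 'I_d.+1 -> 'End(V)).

Lemma idempotent_systemC E Es :
  idempotent_system E Es -> idempotent_system Es E.
Proof. by case. Qed.

Lemma lftrace_compC (X Y : 'End(V)) : lftrace (X \o Y)%VF = lftrace (Y \o X)%VF.
Proof.
have bV := vbasisP (fullv : {vspace V}).
by rewrite /lftrace !(passmx.mxof_comp _ _ bV) mxtrace_mulC.
Qed.

Lemma nuC E Es : nu E Es = nu Es E.
Proof. by rewrite /nu lftrace_compC. Qed.

Lemma As_E E Es i : As_ E Es i = A_ Es E i.
Proof. by rewrite /As_ /A_ nuC. Qed.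

(** This duality reduces every statement about Q-polynomial systems to one about
    P-polynomial systems. *)
Lemma Q_polynomialE E Es : Q_polynomial E Es = P_polynomial Es E.
Proof.
rewrite /Q_polynomial (_ : As_ E Es = A_ Es E) //.
by apply/funext => i; apply: As_E.
Qed.

Section FirstVector.

Variables (E Es : 'I_d.+1 -> 'End(V)) (w : V).
Hypotheses (IS : idempotent_system E Es) (w_neq0 : w != 0).
Hypothesis Es0w : Es ord0 w = w.

Definition family_image (X : 'I_d.+1 -> 'End(V)) (x : V) : d.+1.-tuple V :=
  [tuple X i x | i < d.+1].

Lemma Es0_line x : exists k, Es ord0 x = k *: w.
Proof.
have [_ oEs _ _] := IS; have [v aEs] := orthogonal_adapted dimV oEs.
have lineP y : Es ord0 y \in <[tnth v ord0]>%VS.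
  by rewrite -(adapted_limg _ aEs) memv_img ?memvf.
have /vlineP[a aE] := lineP x; have /vlineP[b bE] := lineP w.
have b0 : b != 0.
  by apply: contraNneq w_neq0 => b0; rewrite -Es0w bE b0 scale0r.
by exists (a / b); rewrite -[in RHS]Es0w bE aE scalerA divfK.
Qed.

Lemma idempotent_first_vector_neq0 i : E i w != 0.
Proof.
have [_ _ _ EsEEs] := IS; apply: contraNneq (EsEEs i) => Eiw.
apply/eqP/lfunP => x; rewrite !comp_lfunE lfunE /=.
by have [k ->] := Es0_line x; rewrite !linearZ /= Eiw linear0 scaler0.
Qed.

Lemma adapted_E_w : adapted E (family_image E w).
Proof.
have [[EE _] _ _ _] := IS.
apply: adapted_intro => // [j|i j]; rewrite !tnth_mktuple.
  exact: idempotent_first_vector_neq0.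
by rewrite -comp_lfunE EE; case: eqVneq => [->|_] //; rewrite lfunE.
Qed.

End FirstVector.

Lemma idempotent_image E x : orthogonal_rank1_idempotents E ->
  E ord0 (E ord0 x) = E ord0 x.
Proof. by case=> EE _; rewrite -comp_lfunE EE eqxx. Qed.

Section ConvolutionBasis.

Variables (E Es : 'I_d.+1 -> 'End(V)) (w : V).
Hypotheses (IS : idempotent_system E Es) (w_neq0 : w != 0).
Hypothesis Es0w : Es ord0 w = w.

Local Notation e := (family_image E w).
Local Notation u := (family_image Es (E ord0 w)).

Lemma adapted_Es_E_w : adapted Es u.
Proof.
have [oE _ _ _] := IS; apply: adapted_E_w (idempotent_systemC IS) _ _.
  exact: idempotent_first_vector_neq0 IS w_neq0 Es0w _.
exact: idempotent_image.
Qed.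

(** In the basis u only one diagonal entry of E_0 Es_0 can be nonzero, and it is
    the scalar by which Es_0 E_0 acts on the line spanned by w. *)
Lemma nu_neq0 : nu E Es != 0.
Proof.
have [bu Esu] := adapted_Es_E_w; have [_ oEs _ EsEEs] := IS.
rewrite /nu invr_eq0 (lftraceE _ bu) (bigD1 ord0) //= big1 => [|i /negPf i0].
  rewrite addr0 comp_lfunE Esu eqxx.
  have [k kE] := Es0_line IS w_neq0 Es0w (E ord0 w).
  have k0 : k != 0.
    apply: contraNneq (tnth_basis_neq0 bu ord0) => k0.
    by rewrite tnth_mktuple kE k0 scale0r.
  have Es0u : Es ord0 (E ord0 (tnth u ord0)) = k *: tnth u ord0.
    by rewrite tnth_mktuple kE !linearZ /= kE.
  suff -> : coord u ord0 (E ord0 (tnth u ord0)) = k by [].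
  have := congr1 (coord u ord0) Es0u.
  rewrite linearZ /= coord_tnth // eqxx mulr1 => <-.
  rewrite [in RHS](basis_expansion bu (E ord0 (tnth u ord0))).
  rewrite linear_sum (bigD1 ord0) //= big1 => [|i /negPf i0].
    by rewrite addr0 !linearZ /= Esu eqxx coord_tnth // eqxx mulr1.
  by rewrite !linearZ /= Esu eq_sym i0 scaler0.
by rewrite comp_lfunE Esu eq_sym i0 !linear0.
Qed.

Lemma A_mem_generated i : A_ E Es i \in generated_subalgebra E.
Proof. by rewrite /A_ rpredZ // subvsP. Qed.

(** With the membership above, this characterizes A_ E Es i: it is the defining
    property of rho Es E, evaluated at w. *)
Lemma A_apply_first_vector i : A_ E Es i w = nu E Es *: tnth u i.
Proof.
have [/(_ (vsproj (generated_subalgebra Es) (Es i))) rhoP _] :=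
  rho_unique dimV (idempotent_systemC IS).
have [_ Es_gen _] := generated_subalgebraP Es.
rewrite vsprojK // in rhoP.
rewrite /A_ scale_lfunE -{1}Es0w -comp_lfunE -rhoP !comp_lfunE Es0w.
by rewrite tnth_mktuple.
Qed.

(** w is separating for the algebra generated by E: all its components E i w are
    nonzero and the algebra acts diagonally on them. *)
Lemma generated_subalgebra_inj X Y :
  X \in generated_subalgebra E -> Y \in generated_subalgebra E ->
  X w = Y w -> X = Y.
Proof.
have aE := adapted_E_w IS w_neq0 Es0w; have [be _] := aE.
move=> /(mem_generated_subalgebraP _ aE)[a Xa].
move=> /(mem_generated_subalgebraP _ aE)[b Yb] XYw.
have ew : w = \sum_i 1 *: tnth e i.
  rewrite -[LHS]id_lfunE -(adapted_sum aE) sum_lfunE.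
  by apply: eq_bigr => i _; rewrite scale1r tnth_mktuple.
have diagw (Z : 'End(V)) (c : 'I_d.+1 -> F) :
    (forall j, Z (tnth e j) = c j *: tnth e j) ->
    Z w = \sum_i c i *: tnth e i.
  move=> Zc; rewrite {1}ew linear_sum; apply: eq_bigr => i _ /=.
  by rewrite scale1r Zc.
apply: (lfun_basisP be) => j; rewrite Xa Yb; congr (_ *: _).
rewrite -(coord_sum_tnth be a) -(diagw X) // XYw (diagw Y b) //.
exact: coord_sum_tnth.
Qed.

Lemma generated_subalgebra_commute X Y :
  X \in generated_subalgebra E -> Y \in generated_subalgebra E ->
  (X \o Y)%VF = (Y \o X)%VF.
Proof.
have aE := adapted_E_w IS w_neq0 Es0w; have [be _] := aE.
move=> /(mem_generated_subalgebraP _ aE)[a Xa].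
move=> /(mem_generated_subalgebraP _ aE)[b Yb].
apply: (lfun_basisP be) => j.
by rewrite !comp_lfunE Yb Xa !linearZ /= Yb Xa !scalerA mulrC.
Qed.

Lemma free_A : free [tuple A_ E Es i | i < d.+1].
Proof.
have [bu _] := adapted_Es_E_w.
apply/freeP => k sum0 i.
have : \sum_j (k j * nu E Es) *: tnth u j = 0.
  have : (0 : 'End(V)) w = 0 by rewrite lfunE.
  rewrite -{1}sum0 sum_lfunE => {2}<-; apply: eq_bigr => j _.
  rewrite scale_lfunE -tnth_nth !tnth_mktuple.
  by rewrite A_apply_first_vector tnth_mktuple scalerA.
move/(congr1 (coord u i)); rewrite linear0 (coord_sum_tnth bu) => /eqP.
by rewrite mulf_eq0 (negPf nu_neq0) orbF => /eqP.
Qed.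

(** Evaluating A_i A_j = \sum_h p^h_ij A_h at w and cancelling nu turns this
    product into the action of A_i on the basis u. *)
Lemma structure_constantE h i j :
  structure_constant (A_ E Es) h i j = coord u h (A_ E Es i (tnth u j)).
Proof.
have [bu _] := adapted_Es_E_w; have [[_ genM] _ _] := generated_subalgebraP E.
pose c k := coord u k (A_ E Es i (tnth u j)).
rewrite /structure_constant.
have -> : (A_ E Es i \o A_ E Es j)%VF =
    \sum_k c k *: tnth [tuple A_ E Es k | k < d.+1] k.
  apply: generated_subalgebra_inj.
  - by apply: genM; apply: A_mem_generated.
  - by apply: rpred_sum => k _; rewrite rpredZ // tnth_mktuple A_mem_generated.
  rewrite comp_lfunE A_apply_first_vector linearZ /=.
  rewrite {1}(basis_expansion bu (A_ _ _ _ _)) sum_lfunE scaler_sumr.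
  apply: eq_bigr => k _.
  rewrite [RHS]scale_lfunE [in RHS]tnth_mktuple A_apply_first_vector !scalerA.
  by congr (_ *: _); apply: mulrC.
under eq_bigr => k _ do rewrite (tnth_nth 0).
by rewrite coord_sum_free ?free_A.
Qed.

Lemma structure_constant_sym h i j :
  structure_constant (A_ E Es) h i j = structure_constant (A_ E Es) h j i.
Proof.
by rewrite /structure_constant generated_subalgebra_commute ?A_mem_generated.
Qed.

End ConvolutionBasis.
End IdempotentSystems.

(** * From polynomial idempotent systems to Leonard systems *)

Section FromPQPolynomial.

Variables (F : fieldType) (V : vectType F) (d : nat).
Hypothesis dimV : \dim {:V} = d.+1.
Implicit Types (E Es : 'I_d.+1 -> 'End(V)) (v w : d.+1.-tuple V).

(** The entries of this matrix are the p^h_1j, whose prescribed zeros and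
    nonzeros are exactly those of an irreducible tridiagonal matrix. *)
Lemma P_polynomial_tridiagonal E Es (w : V) (i1 : 'I_d.+1) :
  idempotent_system E Es -> w != 0 -> Es ord0 w = w ->
  i1 = 1%N :> nat -> P_polynomial E Es ->
  irreducible_tridiagonal (lfmx (family_image Es (E ord0 w)) (A_ E Es i1)).
Proof.
move=> IS w0 Es0w i1E polyP.
have LE h j : lfmx (family_image Es (E ord0 w)) (A_ E Es i1) h j =
    structure_constant (A_ E Es) h i1 j.
  by rewrite (structure_constantE dimV IS w0 Es0w) mxE.
split=> h j hj; rewrite LE; have [c0 cn0] := polyP h i1 j.
  by apply: c0; rewrite i1E; lia.
by apply: cn0; rewrite i1E; lia.
Qed.

(** The basis E_j (Es_0 (E_0 w)) serves both purposes: as any basis adapted to E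
    it diagonalizes A_1, and it is the basis u of the dual system with first
    vector E_0 w, in which the dual of A_1 is tridiagonal. *)
Lemma PQ_polynomial_diagonal_tridiagonal E Es (w : V) (i1 : 'I_d.+1) :
  idempotent_system E Es -> w != 0 -> Es ord0 w = w ->
  i1 = 1%N :> nat -> P_polynomial E Es -> P_polynomial Es E ->
  exists v, diagonal_tridiagonal (A_ E Es i1) (A_ Es E i1) E v.
Proof.
move=> IS w0 Es0w i1E polyP polyPs.
have IS' := idempotent_systemC IS; have [oE oEs _ _] := IS.
have E0w0 := idempotent_first_vector_neq0 dimV IS w0 Es0w ord0.
have E0E0w := idempotent_image w oE.
have [bu _] := adapted_Es_E_w dimV IS w0 Es0w.
have aE := adapted_Es_E_w dimV IS' E0w0 E0E0w; have [bE _] := aE.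
have iM := P_polynomial_tridiagonal IS' E0w0 E0E0w i1E polyPs.
have iMs := P_polynomial_tridiagonal IS w0 Es0w i1E polyP.
have /(mem_generated_subalgebraP _ aE)[th Ath] := A_mem_generated E Es i1.
exists (family_image E (Es ord0 (E ord0 w))); split=> //; last first.
  exists (lfmx (family_image E (Es ord0 (E ord0 w))) (A_ Es E i1)) => //.
  by move=> j; apply: lfmx_tnth.
exists th => //; apply: (tridiagonal_eigenvalues_inj bu bE _ iMs Ath) => j.
exact: lfmx_tnth.
Qed.

Lemma PQ_polynomial_Leonard_system E Es :
  idempotent_system E Es -> P_polynomial E Es -> Q_polynomial E Es ->
  exists A As : 'End(V), Leonard_system A E As Es.
Proof.
move=> IS polyP; rewrite Q_polynomialE => polyPs.
have [oE oEs _ _] := IS.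
have [v aE] := orthogonal_adapted dimV oE.
have [vs aEs] := orthogonal_adapted dimV oEs.
have [d0|d_gt0] := posnP d.
  exists 0, 0; apply/(Leonard_systemP dimV).
  suff half X w : adapted X w -> diagonal_tridiagonal (0 : 'End(V)) 0 X w.
    by split; [exists v|exists vs]; apply: half.
  move=> aX; split=> //.
    exists (fun=> 0) => [i j _|j]; last by rewrite lfunE scale0r.
    by apply: val_inj => /=; move: (ltn_ord i) (ltn_ord j); lia.
  exists 0.
    by move=> j; rewrite lfunE big1 // => i _; rewrite mxE scale0r.
  by split=> i j; move: (ltn_ord i) (ltn_ord j); lia.
have i1E : (inord 1 : 'I_d.+1) = 1%N :> nat by rewrite inordK // ltnS.
have [[bv Ev] [bvs Esv]] := (aE, aEs).
exists (A_ E Es (inord 1)), (A_ Es E (inord 1)); apply/(Leonard_systemP dimV).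
split.
  apply: (PQ_polynomial_diagonal_tridiagonal (w := tnth vs ord0)) => //.
    exact: tnth_basis_neq0.
apply: (PQ_polynomial_diagonal_tridiagonal (w := tnth v ord0)) => //.
  exact: idempotent_systemC.
exact: tnth_basis_neq0.
Qed.

End FromPQPolynomial.

(** * Irreducible tridiagonal matrices *)

Section TridiagonalMatrices.

Variables (F : fieldType) (d : nat).
Implicit Types (B : 'M[F]_d.+1).

(** The diagonal of a matrix K such that K B is symmetric, see
    symmetrizerP. *)
Definition symmetrizer B (n : nat) : F :=
  \prod_(m < n) (B (inord m) (inord m.+1) / B (inord m.+1) (inord m)).

Lemma symmetrizer_neq0 B (i : 'I_d.+1) :
  irreducible_tridiagonal B -> symmetrizer B i != 0.
Proof.
move=> [_ iB]; apply/prodf_neq0 => m _.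
have m_i := ltn_ord m; have i_d := ltn_ord i.
have Em : (inord m : 'I_d.+1) = m :> nat by rewrite inordK //; lia.
have Em1 : (inord m.+1 : 'I_d.+1) = m.+1 :> nat by rewrite inordK //; lia.
by rewrite mulf_neq0 ?invr_eq0 ?iB // Em Em1 eqxx ?orbT.
Qed.

Lemma symmetrizerP B (i j : 'I_d.+1) : irreducible_tridiagonal B ->
  symmetrizer B i * B i j = symmetrizer B j * B j i.
Proof.
move=> [tB iB].
have step (a b : 'I_d.+1) : a.+1 = b :> nat ->
    symmetrizer B a * B a b = symmetrizer B b * B b a.
  move=> ab; rewrite /symmetrizer -ab big_ord_recr /=.
  rewrite (_ : inord a = a) ?inord_val // (_ : inord a.+1 = b).
    by rewrite -mulrA divfK // iB // ab eqxx orbT.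
  by apply: val_inj; rewrite /= inordK // ab.
have [ij|ij|ij] := ltngtP i j.
- have [ij1|ij1] := eqVneq i.+1 j; first exact: step.
  by rewrite !tB ?mulr0 //; lia.
- have [ij1|ij1] := eqVneq j.+1 i; first by apply/esym/step.
  by rewrite !tB ?mulr0 //; lia.
by rewrite (val_inj ij).
Qed.

(** Solving the recurrence for L i shows that L i is a polynomial of degree
    exactly i in B.  The entry at distance i from the diagonal is obtained by
    multiplying the extreme entry of the previous band matrix by an off-diagonal
    entry of B. *)
Lemma tridiagonal_band B (L : 'I_d.+1 -> 'M[F]_d.+1) (a : F) :
  irreducible_tridiagonal B -> a != 0 -> L ord0 = a%:M ->
  (forall i, B *m L i = \sum_h B h i *: L h) ->
  forall i h j : 'I_d.+1,
    (((i + h < j) || (i + j < h))%N -> L i h j = 0) /\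
    (((i + h == j) || (i + j == h))%N -> L i h j != 0).
Proof.
move=> [tB iB] a0 L0 recL i.
have [n] := ubnP (i : nat); elim: n i => // n IHn i; rewrite ltnS => i_n h j.
have [i0|i_gt0] := posnP i.
  have -> : i = ord0 by apply: val_inj.
  rewrite L0 mxE /= !add0n; split=> hj.
    by have /negPf-> : h != j by apply/eqP => hj'; move: hj; rewrite hj' ltnn.
  have -> : h = j by apply: val_inj => /=; lia.
  by rewrite eqxx.
have p_d : (i.-1 < d.+1)%N by have := ltn_ord i; lia.
pose p := Ordinal p_d; have pE : p = i.-1 :> nat by [].
have rec : B i p * L i h j =
    \sum_k B h k * L p k j - \sum_(g | g != i) B g p * L g h j.
  have := congr1 (fun M : 'M_d.+1 => M h j) (recL p).
  rewrite mxE => ->; rewrite summxE (bigD1 i) //= mxE.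
  by under [X in _ = _ + X - _]eq_bigr => g _ do rewrite mxE; rewrite addrK.
have Bip : B i p != 0 by apply: iB; lia.
(* At distance at least i from the diagonal the lower L g vanish. *)
have tail0 : (i + h <= j)%N || (i + j <= h)%N ->
    \sum_(g | g != i) B g p * L g h j = 0.
  move=> hj; apply: big1 => g gi; have gi' : (g != i :> nat) := gi.
  have [g_i|i_g] := ltnP g i; last by rewrite tB ?mul0r //; lia.
  by have [-> //] := IHn g (leq_trans g_i i_n) h j; rewrite ?mulr0 //; lia.
split=> hj.
  have : B i p * L i h j == 0.
    rewrite rec tail0 ?subr0; last by lia.
    rewrite big1 // => k _.
    have [Bhk|Bhk] := boolP ((h.+1 < k) || (k.+1 < h))%N.
      by rewrite tB ?mul0r.
    by have [-> //] := IHn p ltac:(lia) k j; rewrite ?mulr0 //; lia.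
  by rewrite mulf_eq0 (negPf Bip) => /eqP.
(* On the edge of the band a single index k contributes: the neighbour of h on
   the side of j. *)
suff [k hk jk] : exists2 k : 'I_d.+1, B h k * L p k j != 0 &
    forall k', k' != k -> B h k' * L p k' j = 0.
  suff : B i p * L i h j != 0 by apply: contraNneq => ->; rewrite mulr0.
  rewrite rec tail0 ?subr0; last by lia.
  by rewrite (bigD1 k) //= big1 ?addr0.
have [j_h h_d] := (ltn_ord j, ltn_ord h).
case/orP: hj => /eqP hj.
  have k_d : (h.+1 < d.+1)%N by lia.
  exists (Ordinal k_d) => [|k hk].
    rewrite mulf_neq0 //; first by apply: iB; rewrite /= eqxx.
    by have [_] := IHn p ltac:(lia) (Ordinal k_d) j; apply; rewrite /=; lia.
  have hk' : (k != h.+1 :> nat) := hk.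
  have [kh|hk1] := leqP k h; last by rewrite tB ?mul0r //; lia.
  by have [-> //] := IHn p ltac:(lia) k j; rewrite ?mulr0 //; lia.
have k_d : (h.-1 < d.+1)%N by lia.
exists (Ordinal k_d) => [|k hk].
  rewrite mulf_neq0 //; first by apply: iB => /=; lia.
  by have [_] := IHn p ltac:(lia) (Ordinal k_d) j; apply; rewrite /=; lia.
have hk' : (k != h.-1 :> nat) := hk.
have [kh|hk1] := ltnP k h; first by rewrite tB ?mul0r //; lia.
by have [-> //] := IHn p ltac:(lia) k j; rewrite ?mulr0 //; lia.
Qed.

End TridiagonalMatrices.

(** * Antiautomorphism and structure constants of a Leonard system *)

Section FromLeonardSystem.

Variables (F : fieldType) (V : vectType F) (d : nat).
Hypothesis dimV : \dim {:V} = d.+1.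
Implicit Types (A As X Y Z : 'End(V)) (E Es : 'I_d.+1 -> 'End(V)).
Implicit Types (v : d.+1.-tuple V).

Section WeightedTranspose.

Variables (vs : d.+1.-tuple V) (k : 'I_d.+1 -> F).
Hypotheses (bvs : basis_of {:V} vs) (k_neq0 : forall i, k i != 0).

Definition weighted_transpose (N : 'M[F]_d.+1) : 'M[F]_d.+1 :=
  \matrix_(i, j) (k j / k i * N j i).

Fact weighted_transpose_is_linear : linear weighted_transpose.
Proof. by move=> a M N; apply/matrixP => i j; rewrite !mxE mulrDr mulrCA. Qed.
HB.instance Definition _ := GRing.isSemilinear.Build F _ _ _ weighted_transpose
  (GRing.semilinear_linear weighted_transpose_is_linear).

Lemma weighted_transposeK : involutive weighted_transpose.
Proof.
move=> N; apply/matrixP => i j; rewrite !mxE mulrA.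
by rewrite mulrA divfK // divff ?mul1r.
Qed.

Lemma weighted_transposeM M N :
  weighted_transpose (M *m N) = weighted_transpose N *m weighted_transpose M.
Proof.
apply/matrixP => i j; rewrite !mxE mulr_sumr; apply: eq_bigr => l _.
by rewrite !mxE; field; rewrite !k_neq0.
Qed.

(** The adjoint for the symmetric bilinear form in which vs is an orthogonal
   basis and k i is the value of the form at the i-th vector. *)
Definition adjoint : {linear 'End(V) -> 'End(V)} :=
  mxlf vs \o weighted_transpose \o lfmx vs.

Lemma adjointM Y Z : adjoint (Y \o Z)%VF = (adjoint Z \o adjoint Y)%VF.
Proof.
apply: (can_inj (lfmxK bvs)); rewrite (lfmx_comp bvs) /= !mxlfK //.
by rewrite lfmx_comp // weighted_transposeM.
Qed.

Lemma adjoint_antiautomorphism : antiautomorphism adjoint.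
Proof.
split; last exact: adjointM.
by exists adjoint => X /=; rewrite mxlfK // weighted_transposeK lfmxK.
Qed.

Lemma adjoint_id X :
  (forall i j, k i * lfmx vs X i j = k j * lfmx vs X j i) -> adjoint X = X.
Proof.
move=> symX; rewrite -[RHS](lfmxK bvs) /=; congr (mxlf vs _).
apply/matrixP => i j; rewrite mxE mulrAC -symX mulrAC divff ?mul1r //.
Qed.

End WeightedTranspose.

(** The weights symmetrizing the matrix of A make A self-adjoint; the Es i are
    diagonal, hence self-adjoint for any weights. *)
Lemma tridiagonal_antiautomorphism A Es vs M :
  adapted Es vs -> represents vs A M -> irreducible_tridiagonal M ->
  exists2 tau : {linear 'End(V) -> 'End(V)}, antiautomorphism tau
    & tau A = A /\ forall i, tau (Es i) = Es i.
Proof.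
move=> [bvs Esv] vsM iM; pose k (i : 'I_d.+1) := symmetrizer M i.
have k0 i : k i != 0 by apply: symmetrizer_neq0.
exists (adjoint vs k); first exact: adjoint_antiautomorphism.
split=> [|i]; apply: adjoint_id => // h j; rewrite !mxE.
  by rewrite !vsM !coord_sum_tnth // symmetrizerP.
have [<-//|hj] := eqVneq h j.
have off (a b : 'I_d.+1) : a != b -> coord vs a (Es i (tnth vs b)) = 0.
  move=> /negPf ab; rewrite Esv; case: ifP => _; last exact: linear0.
  by rewrite coord_tnth // eq_sym ab.
by rewrite !off ?mulr0 // eq_sym.
Qed.

(** tau (E i) A = theta_i tau (E i), so tau (E i) kills every eigenvector of A
    other than v_i; it fixes v_i because tau preserves the sum of the
    idempotents, which is the identity. *)
Lemma antiautomorphism_fix_idempotents A E v (theta : 'I_d.+1 -> F)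
    (tau : {linear 'End(V) -> 'End(V)}) :
  antiautomorphism tau -> tau A = A -> adapted E v -> injective theta ->
  (forall j, A (tnth v j) = theta j *: tnth v j) ->
  forall i, tau (E i) = E i.
Proof.
move=> [[tau' tauK tauK'] tauM] tauA aE th_inj Av i; have [bv Ev] := aE.
have tau1 : tau \1%VF = \1%VF.
  have := tauM \1%VF (tau' \1%VF); rewrite tauK' comp_lfun1l comp_lfun1l tauK'.
  by move=> /esym.
have AE j : (A \o E j)%VF = theta j *: E j.
  apply: (lfun_basisP bv) => l; rewrite comp_lfunE scale_lfunE Ev.
  by case: eqVneq => [->|_]; rewrite ?Av // linear0 scaler0.
have EA j : (E j \o A)%VF = theta j *: E j.
  apply: (lfun_basisP bv) => l; rewrite comp_lfunE scale_lfunE Av linearZ /= Ev.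
  by case: eqVneq => [->//|_]; rewrite !scaler0.
have tEA j : (tau (E j) \o A)%VF = theta j *: tau (E j).
  by rewrite -{1}tauA -tauM AE linearZ.
have tEv j l : j != l -> tau (E j) (tnth v l) = 0.
  move=> jl; have := congr1 (fun X : 'End(V) => X (tnth v l)) (tEA j).
  rewrite /= comp_lfunE Av scale_lfunE linearZ /= => /eqP.
  rewrite -subr_eq0 -scalerBl scaler_eq0 subr_eq0 (inj_eq th_inj) eq_sym.
  by rewrite (negPf jl) => /eqP.
apply: (lfun_basisP bv) => l; rewrite Ev.
case: eqVneq => [->|]; last exact: tEv.
have := congr1 (fun X : 'End(V) => tau X (tnth v l)) (adapted_sum aE).
rewrite /= tau1 id_lfunE linear_sum sum_lfunE (bigD1 l) //= big1 ?addr0 //.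
by move=> j; apply: tEv.
Qed.

(** The vector v_0 is cyclic for As, because As is irreducible tridiagonal in v.
    As Es i As is a multiple of Es i, the kernel of Es i is stable under As; if
    it contained v_0, it would be the whole space. *)
Lemma idempotent_cyclic_neq0 A As E Es v vs i :
  diagonal_tridiagonal A As E v -> diagonal_tridiagonal As A Es vs ->
  Es i (tnth v ord0) != 0.
Proof.
move=> [[bv Ev] _ [M vM [tM iM]]] [[bvs Esv] [ths _ Asv] _].
have EsAs x : Es i (As x) = ths i *: Es i x.
  rewrite (basis_expansion bvs x) !linear_sum; apply: eq_bigr => j _ /=.
  rewrite !linearZ /= Asv !linearZ /= Esv; case: eqVneq => [->//|_].
  by rewrite !scaler0.
apply/eqP => Es0.
suff Esv0 n : (n <= d)%N ->
    forall j : 'I_d.+1, (j <= n)%N -> Es i (tnth v j) = 0.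
  have Esi0 : Es i = 0.
    apply: (lfun_basisP bv) => j; rewrite lfunE /= (Esv0 d) // -ltnS //.
  have := tnth_basis_neq0 bvs i; have := Esv i i; rewrite eqxx => <-.
  by rewrite Esi0 lfunE eqxx.
elim: n => [|n IHn] n_d j.
  rewrite leqn0 => /eqP j0; rewrite -[RHS]Es0; congr (Es i (tnth v _)).
  exact: val_inj.
rewrite leq_eqVlt => /orP[/eqP jn|/IHn]; last by apply; apply: ltnW.
have p_d : (n < d.+1)%N by lia.
pose p := Ordinal p_d.
have := EsAs (tnth v p); rewrite (IHn _ p) ?(ltnW n_d) // scaler0 vM.
rewrite linear_sum (bigD1 j) //= big1 => [|k kj].
  rewrite addr0 linearZ /= => /eqP; rewrite scaler_eq0 => /orP[/negPn|/eqP //].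
  by rewrite iM //= jn eqxx orbT.
rewrite linearZ /=; have [kn|nk] := leqP k n.
  by rewrite IHn ?scaler0 // ltnW.
rewrite tM ?scale0r //=; apply/orP; right.
by rewrite -jn; have : (k != j :> nat) := kj; lia.
Qed.

(** By cyclicity Es_i E_0 is nonzero, so it has the image of Es_i; were
    E_0 Es_i E_0 zero, so would be E_0 Es_i, the image of Es_i E_0 under tau. *)
Lemma idempotent_sandwich_neq0 A As E Es v vs i
    (tau : {linear 'End(V) -> 'End(V)}) :
  diagonal_tridiagonal A As E v -> diagonal_tridiagonal As A Es vs ->
  antiautomorphism tau -> (forall i, tau (E i) = E i) ->
  (forall i, tau (Es i) = Es i) -> (E ord0 \o Es i \o E ord0)%VF != 0.
Proof.
move=> hE hEs [_ tauM] tauE tauEs.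
have Esi0 := idempotent_cyclic_neq0 i hE hEs.
have [[bv Ev] _ _] := hE; have [aEs _ _] := hEs; have [bvs Esv] := aEs.
have EsE : (Es i \o E ord0)%VF != 0.
  apply: contraNneq Esi0 => /(congr1 (fun X : 'End(V) => X (tnth v ord0))).
  by rewrite /= comp_lfunE Ev eqxx lfunE => ->.
have EEs : (E ord0 \o Es i)%VF != 0.
  apply: contraNneq EsE => EEs0.
  by rewrite -(tauE ord0) -(tauEs i) -tauM EEs0 linear0.
have /vlineP[c Esiv] : Es i (tnth v ord0) \in <[tnth vs i]>%VS.
  by rewrite -(adapted_limg _ aEs) memv_img ?memvf.
have c0 : c != 0.
  by apply: contraNneq Esi0 => c0; rewrite Esiv c0 scale0r.
apply: contraNneq EEs => /(congr1 (fun X : 'End(V) => X (tnth v ord0))).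
rewrite /= !comp_lfunE Ev eqxx Esiv linearZ lfunE /= => /eqP.
rewrite scaler_eq0 (negPf c0) /= => /eqP Evs.
apply/eqP/(lfun_basisP bvs) => j; rewrite comp_lfunE Esv lfunE /=.
by case: eqVneq => [<-|_]; rewrite ?linear0.
Qed.

(** A A_i w = nu A u_i expresses A A_i through the A_h with the coefficients of
    the matrix of A, which is the recurrence of tridiagonal_band. *)
Lemma Leonard_P_polynomial A As E Es v vs :
  idempotent_system E Es ->
  diagonal_tridiagonal A As E v -> diagonal_tridiagonal As A Es vs ->
  P_polynomial E Es.
Proof.
move=> IS [aE [th _ Av] _] [aEs _ [M vsM iM]].
have [bv Ev] := aE; have [bvs Esv] := aEs.
pose w := tnth vs ord0.
have w0 : w != 0 by apply: tnth_basis_neq0.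
have Es0w : Es ord0 w = w by rewrite Esv eqxx.
have aU := adapted_Es_E_w dimV IS w0 Es0w; have [bU EsU] := aU.
set u := family_image Es _ in aU bU EsU.
have [_ [k [k0 uE]]] :=
  adapted_rescale dimV aEs (fun i => mem_limg_adapted i aU).
have [B uB iB] := irreducible_tridiagonal_rescale k0 uE vsM iM.
have nu0 := nu_neq0 dimV IS w0 Es0w.
have Aw := A_apply_first_vector dimV IS Es0w.
pose L i := lfmx u (A_ E Es i).
have LE h i j : L i h j = structure_constant (A_ E Es) h i j.
  by rewrite (structure_constantE dimV IS w0 Es0w) mxE.
have [[one_mem genM] _ _] := generated_subalgebraP E.
have Agen : A \in generated_subalgebra E.
  by apply/(mem_generated_subalgebraP _ aE); exists th.
have recA i : (A \o A_ E Es i)%VF = \sum_h B h i *: A_ E Es h.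
  apply: (generated_subalgebra_inj dimV IS w0 Es0w).
  - by apply: genM => //; apply: A_mem_generated.
  - by apply: rpred_sum => h _; rewrite rpredZ // A_mem_generated.
  rewrite comp_lfunE Aw linearZ /= uB sum_lfunE scaler_sumr.
  apply: eq_bigr => h _; rewrite [RHS]scale_lfunE Aw !scalerA.
  by congr (_ *: _); apply: mulrC.
have BE : lfmx u A = B.
  by apply/matrixP => i j; rewrite mxE uB coord_sum_tnth.
have recL i : B *m L i = \sum_h B h i *: L h.
  rewrite -BE -lfmx_comp // recA linear_sum; apply: eq_bigr => h _.
  by rewrite linearZ BE.
have [a aE0] := Es0_line dimV IS w0 Es0w (E ord0 w).
have a0 : a != 0.
  apply: contraNneq (tnth_basis_neq0 bU ord0) => a0.
  by rewrite tnth_mktuple aE0 a0 scale0r.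
have A0 : A_ E Es ord0 = (nu E Es * a) *: \1%VF.
  apply: (generated_subalgebra_inj dimV IS w0 Es0w).
    exact: A_mem_generated.
    by rewrite rpredZ.
  by rewrite Aw tnth_mktuple aE0 scalerA scale_lfunE id_lfunE.
have L0 : L ord0 = (nu E Es * a)%:M.
  rewrite /L A0 linearZ /=; apply/matrixP => i j.
  by rewrite !mxE id_lfunE coord_tnth // eq_sym mulr_natr.
have band := tridiagonal_band iB (mulf_neq0 nu0 a0) L0 recL.
have sym := structure_constant_sym dimV IS w0 Es0w.
move=> h i j; have [z1 n1] := band i h j; have [z2 n2] := band j h i.
rewrite !LE in z1 n1; rewrite !LE sym in z2 n2.
split=> [/or3P[]|/or3P[]] hij.
- by apply: z1; lia.
- by apply: z2; lia.
- by apply: z1; lia.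
- by apply: n1; lia.
- by apply: n2; lia.
by apply: n1; lia.
Qed.

Lemma Leonard_system_PQ_polynomial A As E Es :
  Leonard_system A E As Es ->
  symmetric_idempotent_system E Es /\ P_polynomial E Es /\ Q_polynomial E Es.
Proof.
move=> /(Leonard_systemP dimV)[[v hE] [vs hEs]].
have [aE [th th_inj Av] _] := hE; have [aEs _ [M vsM iM]] := hEs.
have [tau tauP [tauA tauEs]] := tridiagonal_antiautomorphism aEs vsM iM.
have tauE := antiautomorphism_fix_idempotents tauP tauA aE th_inj Av.
have IS : idempotent_system E Es.
  split.
  - exact: adapted_orthogonal aE.
  - exact: adapted_orthogonal aEs.
  - by move=> i; apply: (idempotent_sandwich_neq0 i hE hEs tauP).
  by move=> i; apply: (idempotent_sandwich_neq0 i hEs hE tauP).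
split; first by split=> //; exists tau.
rewrite Q_polynomialE; split; first exact: Leonard_P_polynomial IS hE hEs.
exact: Leonard_P_polynomial (idempotent_systemC IS) hEs hE.
Qed.

End FromLeonardSystem.

Theorem theorem21p1 (F : fieldType) (d : nat) (V : vectType F)
    (hV : \dim {:V} = d.+1) (E Es : 'I_d.+1 -> 'End(V)) :
  (symmetric_idempotent_system E Es /\ P_polynomial E Es /\ Q_polynomial E Es)
  <->
  (exists A As : 'End(V), Leonard_system A E As Es).
Proof.
split=> [[[IS _] [polyP polyQ]]|[A [As LS]]].
  exact: PQ_polynomial_Leonard_system.
exact: Leonard_system_PQ_polynomial LS.
Qed.
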